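(* \[ B^{\mathrm{des}}(x,t)=\exp\!\left(x+2\sum_{k\ge1}\sum_{d\le k-1}E(2k,d)\,t^{d+1}\frac{x^{2k+1}}{(2k+1)!}\right). \]
   Context: For a permutation $\pi=\pi_1\cdots\pi_n$, $\operatorname{des}(\pi)$ is the number of $1\le i\le n-1$ with $\pi_i>\pi_{i+1}$ and $\operatorname{asc}(\pi)$ the number with $\pi_i<\pi_{i+1}$. A ballot permutation is one with $\operatorname{asc}(\pi_1\cdots\pi_i)\ge\operatorname{des}(\pi_1\cdots\pi_i)$ for all $i$; $\mathscr B_n$ is the set of ballot permutations of $[n]$, $\mathscr B_0=\{\epsilon\}$ with $\operatorname{des}(\epsilon)=0$. $B^{\mathrm{des}}(x,t)=\sum_{n\ge0}\sum_{\pi\in\mathscr B_n}t^{\operatorname{des}(\pi)}\frac{x^n}{n!}$. $E(n,d)$ is the Eulerian number, the number of permutations of $[n]$ with $d$ descents, with $E(n,d)=0$ when $d<0$ (so the inner sum is over $0\le d\le k-1$). *)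

(* Defs.v *)
From mathcomp Require Import all_boot all_order all_algebra all_fingroup.
Set Implicit Arguments. Unset Strict Implicit. Unset Printing Implicit Defensive.
Import GRing.Theory Num.Theory.
Local Open Scope ring_scope.

Definition des_seq (s : seq nat) : nat :=
  count (fun i => nth 0%N s i.+1 < nth 0%N s i)%N (iota 0 (size s).-1).
Definition asc_seq (s : seq nat) : nat :=
  count (fun i => nth 0%N s i < nth 0%N s i.+1)%N (iota 0 (size s).-1).

(* one-line notation of a permutation of 'I_n (values 0..n-1, order-isomorphic to [n]) *)
Definition perm_word n (p : 'S_n) : seq nat := [seq (p i : nat) | i <- enum 'I_n].

Definition des_perm n (p : 'S_n) : nat := des_seq (perm_word p).

Definition ballot n (p : 'S_n) : bool :=
  [forall i : 'I_n.+1, des_seq (take i (perm_word p)) <= asc_seq (take i (perm_word p))]%N.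

Definition eulerian (n d : nat) : nat := #|[set p : 'S_n | des_perm p == d]|.

(* n! times the coefficient of x^n in B^des(x,t): a polynomial in t *)
Definition Bdes_coef (n : nat) : {poly rat} := \sum_(p : 'S_n | ballot p) 'X^(des_perm p).

(* the exponent  x + 2 sum_{k>=1} sum_{d<=k-1} E(2k,d) t^{d+1} x^{2k+1}/(2k+1)!,
   truncated to k <= N (outer variable x, coefficients in Q[t]) *)
Definition exponent_trunc (N : nat) : {poly {poly rat}} :=
  'X + 2%:R * \sum_(1 <= k < N.+1) \sum_(d < k)
     (((eulerian (2 * k) d)%:R / ((2 * k).+1)`!%:R : rat) *: 'X^(d.+1))%:P * 'X^((2 * k).+1).

Definition exp_trunc (N : nat) (g : {poly {poly rat}}) : {poly {poly rat}} :=
  \sum_(j < N.+1) (((j`!)%:R^-1 : rat)%:P)%:P * g ^+ j.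

(* Main.v *)
(* Put the weight t on every descent and read a permutation as a path whose
   steps are its ascents (up) and descents (down).  A word cut at the last, or at
   the first, minimum of its path splits into a word ending at its minimum and a
   ballot word; summing over both cuts gives V * U = 1 + (1 + t) P, where U is the
   series of the theorem, 1 + (V - 1)/t counts the words ending at their minimum
   and P is the Eulerian series without its constant term.  From
   P' = (1 + P)(1 + t P) the logarithmic derivative of the right-hand side is
   1 + t + t (P(x) + P(-x)).  In U the monomials x^i t^j satisfy 2j <= i, in V - 1
   they satisfy 2j > i, so the logarithmic derivative of U is the part of this
   expression with 2j <= i, which is the derivative of the exponent. *)
Require Import Defs.
From mathcomp Require Import all_boot all_order all_algebra all_fingroup.
From mathcomp Require Import ring zify.
Set Implicit Arguments. Unset Strict Implicit. Unset Printing Implicit Defensive.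
Import GRing.Theory Num.Theory.
Local Open Scope ring_scope.

(** * One-line words of permutations *)

Lemma size_perm_word n (p : 'S_n) : size (perm_word p) = n.
Proof. by rewrite size_map size_enum_ord. Qed.

Lemma nth_perm_word n (p : 'S_n) (i : 'I_n) : nth 0%N (perm_word p) i = p i.
Proof. by rewrite (nth_map i) ?size_enum_ord // nth_ord_enum. Qed.

Lemma perm_word_uniq n (p : 'S_n) : uniq (perm_word p).
Proof.
rewrite map_inj_in_uniq ?enum_uniq // => i j _ _ eq_ij.
by apply: (@perm_inj _ p); apply: val_inj.
Qed.

(** * Words of independent permutations *)

(** Dependence on the relative order of the letters only. Such an [f] can be evaluated on a factor
    of a permutation word, whose letters need not form an initial segment of the naturals. *)
Definition order_invariant (T : Type) (f : seq nat -> T) : Prop :=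
  forall (h : nat -> nat) (s : seq nat),
    {in s &, {mono h : x y / (x < y)%N}} -> f (map h s) = f s.

(** Sorting [w] gives an increasing map [h] from ranks to letters. Up to [h], rearranging [w] by [s]
    amounts to composing [s] with the rank permutation of [w], a bijection of ['S_k]. *)
Lemma sum_rearrangements (V : nmodType) (f : seq nat -> V) (w : seq nat) k :
    order_invariant f -> uniq w -> size w = k ->
  \sum_(s : 'S_k) f [seq nth 0%N w (s i) | i <- enum 'I_k]
    = \sum_(s : 'S_k) f (perm_word s).
Proof.
move=> finv uw sw; set v := sort leq w; pose h := nth 0%N v.
have pvw : perm_eq v w by rewrite perm_sort.
have sv : size v = k by rewrite size_sort.
have uv : uniq v by rewrite sort_uniq.
have hmono : {in [pred n | (n < k)%N] &, {mono h : i j / (i < j)%N}}.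
  have hlt : {in [pred n | (n < size v)%N] &, {homo h : i j / (i < j)%N}}.
    apply: sorted_ltn_nth; first exact: ltn_trans.
    by rewrite ltn_sorted_uniq_leq uv; apply: sort_sorted; apply: leq_total.
  move=> i j; rewrite -sv => ik jk; case: (ltngtP i j) => [/hlt-> //|/hlt|->].
    by move=> /(_ jk ik) /ltnW; rewrite leqNgt => /negbTE.
  by rewrite ltnn.
have rk (i : 'I_k) : (index (nth 0%N w i) v < k)%N.
  by rewrite -[X in (_ < X)%N]sv index_mem (perm_mem pvw) mem_nth ?sw.
pose rank_fun i := Ordinal (rk i).
have rank_inj : injective rank_fun.
  move=> i j /(congr1 val) /= /(congr1 (nth 0%N v)).
  rewrite !nth_index ?(perm_mem pvw) ?mem_nth ?sw // => /eqP.
  by rewrite nth_uniq ?sw // => /eqP /val_inj.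
pose rk_perm := perm rank_inj.
rewrite [RHS](reindex_inj (mulIg rk_perm)) /=.
apply: eq_bigr => s _; rewrite -[RHS](finv h).
  congr f; rewrite /perm_word -map_comp; apply: eq_map => i /=.
  by rewrite permM permE /h /= nth_index // (perm_mem pvw) mem_nth ?sw.
by move=> _ _ /mapP[i _ ->] /mapP[j _ ->]; apply: hmono; rewrite inE.
Qed.

Definition block_perm_fun k m (s : 'S_k) (t : 'S_m) (i : 'I_(k + m)) : 'I_(k + m) :=
  match split i with inl a => lshift m (s a) | inr b => rshift k (t b) end.

Lemma block_perm_fun_inj k m (s : 'S_k) (t : 'S_m) : injective (block_perm_fun s t).
Proof.
apply: (can_inj (g := block_perm_fun s^-1%g t^-1%g)) => i; rewrite /block_perm_fun.
case: (split_ordP i) => j ->.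
  by rewrite (unsplitK (inl _)) permK.
by rewrite (unsplitK (inr _)) permK.
Qed.

Definition block_perm k m (s : 'S_k) (t : 'S_m) : 'S_(k + m) :=
  perm (@block_perm_fun_inj k m s t).

(** In [block_perm s t * p] the block permutation acts first, hence on positions, so it only
    rearranges letters inside each factor. *)
Lemma take_block_perm k m (s : 'S_k) (t : 'S_m) (p : 'S_(k + m)) :
  take k (perm_word (block_perm s t * p)%g) =
  [seq nth 0%N (take k (perm_word p)) (s i) | i <- enum 'I_k].
Proof.
have st : size (take k (perm_word (block_perm s t * p)%g)) = k.
  by rewrite size_takel // size_perm_word leq_addr.
apply: (@eq_from_nth _ 0%N); first by rewrite st size_map size_enum_ord.
move=> i; rewrite st => ik; rewrite nth_take //.
rewrite (nth_map (Ordinal ik)) ?size_enum_ord //.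
rewrite (nth_ord_enum _ (Ordinal ik)) nth_take //.
rewrite (nth_perm_word _ (lshift m (Ordinal ik))) (nth_perm_word p (lshift m (s _))).
by rewrite permM permE /block_perm_fun (unsplitK (inl _)).
Qed.

Lemma drop_block_perm k m (s : 'S_k) (t : 'S_m) (p : 'S_(k + m)) :
  drop k (perm_word (block_perm s t * p)%g) =
  [seq nth 0%N (drop k (perm_word p)) (t i) | i <- enum 'I_m].
Proof.
have st : size (drop k (perm_word (block_perm s t * p)%g)) = m.
  by rewrite size_drop size_perm_word addKn.
apply: (@eq_from_nth _ 0%N); first by rewrite st size_map size_enum_ord.
move=> i; rewrite st => im; rewrite nth_drop.
rewrite (nth_map (Ordinal im)) ?size_enum_ord //.
rewrite (nth_ord_enum _ (Ordinal im)) nth_drop.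
rewrite (nth_perm_word _ (rshift k (Ordinal im))) (nth_perm_word p (rshift k (t _))).
by rewrite permM permE /block_perm_fun (unsplitK (inr _)).
Qed.

Lemma sum_const_perm (V : nmodType) n (x : V) : \sum_(p : 'S_n) x = x *+ n`!.
Proof. by rewrite sumr_const -card_Sn; congr (_ *+ _); apply: eq_card. Qed.

(* Averaging over the action of S_k x S_m on positions replaces the two factors
   of the word by independent uniform permutations. *)
Lemma sum_perm_split (R : comNzRingType) (f g : seq nat -> R) k m :
    order_invariant f -> order_invariant g ->
  (\sum_(p : 'S_(k + m)) f (take k (perm_word p)) * g (drop k (perm_word p)))
      *+ (k`! * m`!)
  = ((\sum_(s : 'S_k) f (perm_word s)) * (\sum_(t : 'S_m) g (perm_word t)))
      *+ (k + m)`!.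
Proof.
move=> finv ginv.
pose F (p : 'S_(k + m)) := f (take k (perm_word p)) * g (drop k (perm_word p)).
(* Each of the k! m! left translations by [block_perm s t] is a bijection, so it preserves the sum
   over [p]. *)
transitivity (\sum_(p : 'S_(k + m)) \sum_(s : 'S_k) \sum_(t : 'S_m)
    F (block_perm s t * p)%g).
  rewrite exchange_big /=.
  have -> : \sum_(s : 'S_k) \sum_(p : 'S_(k + m)) \sum_(t : 'S_m)
      F (block_perm s t * p)%g = \sum_(s : 'S_k) \sum_(t : 'S_m) \sum_p F p.
    apply: eq_bigr => s _; rewrite exchange_big /=; apply: eq_bigr => t _.
    by rewrite [RHS](reindex_inj (mulgI (block_perm s t))).
  by rewrite !sum_const_perm -mulrnA mulnC.
rewrite -sum_const_perm; apply: eq_bigr => p _.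
rewrite /F -(sum_rearrangements finv
  (take_uniq k (perm_word_uniq p))); last first.
  by rewrite size_takel // size_perm_word leq_addr.
rewrite -(sum_rearrangements ginv (drop_uniq k (perm_word_uniq p))); last first.
  by rewrite size_drop size_perm_word addKn.
rewrite big_distrl /=; apply: eq_bigr => s _.
rewrite big_distrr /=; apply: eq_bigr => t _.
by rewrite take_block_perm drop_block_perm.
Qed.

(** * Cutting a word at the minimum of its path *)

Lemma des_seqE (s : seq nat) :
  des_seq s = (\sum_(0 <= j < (size s).-1) (nth 0 s j.+1 < nth 0 s j))%N.
Proof.
rewrite /des_seq -sum1_count big_mkcond /index_iota subn0.
by apply: eq_bigr => i _; case: ifP.
Qed.

Lemma asc_seqE (s : seq nat) :
  asc_seq s = (\sum_(0 <= j < (size s).-1) (nth 0 s j < nth 0 s j.+1))%N.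
Proof.
rewrite /asc_seq -sum1_count big_mkcond /index_iota subn0.
by apply: eq_bigr => i _; case: ifP.
Qed.

Lemma des_seq_map : order_invariant des_seq.
Proof.
move=> h s hmono; rewrite !des_seqE size_map; apply: eq_big_nat => j /andP[_ js].
have [j1s j0s] : (j.+1 < size s)%N /\ (j < size s)%N by lia.
by rewrite !(nth_map 0%N) // hmono ?mem_nth.
Qed.

Lemma asc_seq_map : order_invariant asc_seq.
Proof.
move=> h s hmono; rewrite !asc_seqE size_map; apply: eq_big_nat => j /andP[_ js].
have [j1s j0s] : (j.+1 < size s)%N /\ (j < size s)%N by lia.
by rewrite !(nth_map 0%N) // hmono ?mem_nth.
Qed.

Lemma des_seq_take (w : seq nat) k : (k <= size w)%N ->
  des_seq (take k w) = (\sum_(0 <= j < k.-1) (nth 0 w j.+1 < nth 0 w j))%N.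
Proof.
move=> kw; rewrite des_seqE (size_takel kw).
by apply: eq_big_nat => j /andP[_ jk]; rewrite !nth_take //; lia.
Qed.

Lemma des_seq_drop (w : seq nat) k :
  des_seq (drop k w)
    = (\sum_(k <= j < (size w).-1) (nth 0 w j.+1 < nth 0 w j))%N.
Proof.
rewrite des_seqE size_drop -[k in RHS]add0n big_addn.
have -> : ((size w).-1 - k = (size w - k).-1)%N by lia.
by apply: eq_bigr => j _; rewrite !nth_drop addnS (addnC k).
Qed.

Lemma des_seq_split (w : seq nat) k : (0 < k < size w)%N ->
  des_seq w
    = (des_seq (take k w) + (nth 0 w k < nth 0 w k.-1) + des_seq (drop k w))%N.
Proof.
move=> /andP[k0 kw]; rewrite (des_seq_take (ltnW kw)) des_seq_drop des_seqE.
rewrite (big_cat_nat (n := k)) //=; last by lia.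
by rewrite -{1}(prednK k0) big_nat_recr //= (prednK k0).
Qed.

(** The path has one vertex per letter, so only indices below [size w] are meaningful. *)
Definition height (w : seq nat) (i : nat) : int :=
  \sum_(0 <= j < i)
    ((nth 0 w j < nth 0 w j.+1)%N%:Z - (nth 0 w j.+1 < nth 0 w j)%N%:Z).

Lemma heightS (w : seq nat) i : height w i.+1 =
  height w i + ((nth 0 w i < nth 0 w i.+1)%N%:Z - (nth 0 w i.+1 < nth 0 w i)%N%:Z).
Proof. by rewrite /height big_nat_recr. Qed.

(** The factor with letters [a] to [b.-1] has exactly the steps between these two vertices, and
    their signed count telescopes. *)
Lemma asc_sub_des_seq (w : seq nat) a b : (a < b <= size w)%N ->
  (asc_seq (take (b - a) (drop a w)))%:Z - (des_seq (take (b - a) (drop a w)))%:Z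
    = height w b.-1 - height w a.
Proof.
move=> /andP[ab bw]; rewrite asc_seqE des_seqE size_takel ?size_drop; last by lia.
have -> : height w b.-1 - height w a = \sum_(a <= j < b.-1)
   ((nth 0 w j < nth 0 w j.+1)%N%:Z - (nth 0 w j.+1 < nth 0 w j)%N%:Z).
  rewrite /height [in LHS](@big_cat_nat _ _ _ a 0 b.-1) //=; last by lia.
  by rewrite addrAC subrr add0r.
rewrite -[X in \sum_(X <= _ < b.-1) _]add0n big_addn.
have -> : (b.-1 - a = (b - a).-1)%N by lia.
rewrite !(rmorph_sum Posz) -sumrB /=; apply: eq_big_nat => j /andP[_ jb].
by rewrite !nth_take ?nth_drop ?addnS ?(addnC a) //; lia.
Qed.

(** * Ballot words and words ending at their minimum *)

Definition ballot_seq (w : seq nat) : bool :=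
  all (fun i => des_seq (take i w) <= asc_seq (take i w))%N (iota 0 (size w).+1).

(** The suffix conditions say that no vertex of the path is lower than its last one. *)
Definition coballot_seq (w : seq nat) : bool :=
  all (fun i => asc_seq (drop i w) <= des_seq (drop i w))%N (iota 0 (size w)).

Lemma ballotE n (p : 'S_n) : ballot p = ballot_seq (perm_word p).
Proof.
apply/forallP/allP => [bp i|bp i].
  by rewrite mem_iota size_perm_word => /= ilt; apply: (bp (Ordinal ilt)).
by apply: bp; rewrite mem_iota size_perm_word /=.
Qed.

Lemma ballot_seq_map : order_invariant ballot_seq.
Proof.
move=> h w hmono; rewrite /ballot_seq size_map; apply: eq_all => i.
rewrite -map_take des_seq_map ?asc_seq_map // => x y xw yw;
  by apply: hmono; apply: mem_take; eassumption.
Qed.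

Lemma coballot_seq_map : order_invariant coballot_seq.
Proof.
move=> h w hmono; rewrite /coballot_seq size_map; apply: eq_all => i.
rewrite -map_drop des_seq_map ?asc_seq_map // => x y xw yw;
  by apply: hmono; apply: mem_drop; eassumption.
Qed.

Lemma ballot_seq_drop (w : seq nat) k : (k < size w)%N ->
  ballot_seq (drop k w) <->
  (forall i, (k <= i < size w)%N -> height w k <= height w i).
Proof.
move=> kw; split=> [/allP bw i /andP[ki iw]|hw].
  have := bw (i.+1 - k)%N; rewrite mem_iota size_drop => /(_ ltac:(lia)).
  by have /= := @asc_sub_des_seq w k i.+1 ltac:(lia); lia.
apply/allP => -[|i]; rewrite mem_iota size_drop; first by rewrite take0.
move=> ilt; have := @asc_sub_des_seq w k (k + i.+1) ltac:(lia).
by rewrite addKn addnS /=; have := hw (k + i)%N ltac:(lia); lia.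
Qed.

Lemma coballot_seq_take (w : seq nat) k : (0 < k <= size w)%N ->
  coballot_seq (take k w) <->
  (forall i, (i < k)%N -> height w k.-1 <= height w i).
Proof.
move=> /andP[k0 kw]; rewrite /coballot_seq size_takel //.
have key i : (i < k)%N ->
    (asc_seq (drop i (take k w)))%:Z - (des_seq (drop i (take k w)))%:Z
    = height w k.-1 - height w i.
  move=> ik; rewrite -asc_sub_des_seq ?ik //.
  by rewrite take_drop subnK ?(ltnW ik).
split=> [/allP bw i ik|hw].
  have := bw i; rewrite mem_iota => /(_ ltac:(lia)).
  by have := key i ik; lia.
apply/allP => i; rewrite mem_iota => ik.
by have := key i ltac:(lia); have := hw i ltac:(lia); lia.
Qed.

(* The last minimum for [c = false], the first one for [c = true]. *)
Definition is_argmin (c : bool) (h : nat -> int) (n j : nat) : Prop :=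
  (forall i, (i < j)%N -> h j + c%:Z <= h i) /\
  (forall i, (j < i < n)%N -> h j + (~~ c)%:Z <= h i).

Lemma ex_argmin c h n : (0 < n)%N -> exists2 j, (j < n)%N & is_argmin c h n j.
Proof.
case: n => // n _; elim: n => [|n [j jn [hl hr]]].
  by exists 0%N => //; split=> i iltn; lia.
(* The new index [n.+1] displaces [j] when it is strictly lower ([c = true]) or at most as high
   ([c = false]). *)
have [hle|hlt] := boolP (h j + (~~ c)%:Z <= h n.+1).
  exists j; first exact: ltnW.
  split=> // i; have [->|ni] := eqVneq i n.+1; first by lia.
  by move=> ij; apply: hr; lia.
exists n.+1 => //; split=> i; last by move=> iltn; lia.
move=> ilt; have [ij|ji|->] := ltngtP i j; last by case: (c) hlt => /=; lia.
  by have := hl i ij; case: (c) hlt => /=; lia.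
by have := hr i ltac:(lia); case: (c) hlt => /=; lia.
Qed.

(** The argmin is unique: of two candidates, each would have to be at most as high as the other, one
    of them strictly lower. *)
Lemma sum_argmin c h n (b : nat -> bool) : (0 < n)%N ->
    (forall j, (j < n)%N -> b j <-> is_argmin c h n j) ->
  (\sum_(j < n) b j = 1)%N.
Proof.
move=> n0 bP; have [j jn jmin] := ex_argmin c h n0.
rewrite (bigD1 (Ordinal jn)) //= big1 => [|i ij].
  by have /(bP j jn) -> := jmin.
have {}ij : (i : nat) <> j by move=> eij; case/eqP: ij; apply: val_inj.
apply/eqP; rewrite eqb0; apply/negP => /(bP i (ltn_ord i)) [il ir].
case: jmin => jl jr; have iltn := ltn_ord i.
have [lij|lji|//] := ltngtP i j.
  by have := jl i lij; have := ir j ltac:(lia); case: (c) => /=; lia.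
by have := il j lji; have := jr i ltac:(lia); case: (c) => /=; lia.
Qed.

(** The only such cut is the one just after the last minimum: there the next step, if any, must go
    up. *)
Lemma sum_cut_ascent (w : seq nat) : (0 < size w)%N ->
  (\sum_(j < size w) [&& coballot_seq (take j.+1 w), ballot_seq (drop j.+1 w) &
     (j.+1 == size w) || (nth 0 w j < nth 0 w j.+1)] = 1)%N.
Proof.
move=> w0; apply: (@sum_argmin false (height w) _ (fun j =>
  [&& coballot_seq (take j.+1 w), ballot_seq (drop j.+1 w) &
     (j.+1 == size w) || (nth 0 w j < nth 0 w j.+1)%N])) => // j jw.
rewrite /is_argmin addr0; split=> [/and3P[]|[hl hr]].
  move=> /(coballot_seq_take _) hl hr hj; split=> i ij.
    by apply: hl => //; lia.
  have jw' : (j.+1 < size w)%N by lia.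
  move: hj => /orP[/eqP|]; first by lia.
  move=> jlt; have := (ballot_seq_drop jw').1 hr i ltac:(lia).
  by have := heightS w j; lia.
apply/and3P; split.
- apply/coballot_seq_take; first by lia.
  by move=> i; rewrite ltnS leq_eqVlt => /orP[/eqP -> //|/hl].
- have [jw'|jw'] := ltnP j.+1 (size w); last by rewrite drop_oversize.
  (* A step rises by at most one, while every vertex after [j] is at least one higher than [j];
     hence [j.+1] is a minimum of the rest. *)
  apply/ballot_seq_drop => // i /andP[ji iw].
  have := hr i ltac:(lia); have := hr j.+1 ltac:(lia); have := heightS w j.
  by case: ltnP; case: ltnP => //=; lia.
have [//|jw'] := eqVneq j.+1 (size w) => /=.
by have := hr j.+1 ltac:(lia); have := heightS w j; lia.
Qed.

(** The only such cut is the one just before the first minimum, which is reached by a descent unless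
    it is the first letter. *)
Lemma sum_cut_descent (w : seq nat) : (0 < size w)%N ->
  (\sum_(j < size w) [&& coballot_seq (take j w), ballot_seq (drop j w) &
     (j == 0 :> nat) || (nth 0 w j < nth 0 w j.-1)] = 1)%N.
Proof.
move=> w0; apply: (@sum_argmin true (height w) _ (fun j =>
  [&& coballot_seq (take j w), ballot_seq (drop j w) &
     (j == 0)%N || (nth 0 w j < nth 0 w j.-1)%N])) => // j jw.
rewrite /is_argmin addr0; split=> [/and3P[]|[hl hr]].
  move=> hl /(ballot_seq_drop jw) hr hj; split=> i ij; last by apply: hr; lia.
  case: j jw hl hr hj ij => // j jw /coballot_seq_take hl _ /= hj ij.
  by have /= := hl ltac:(lia) i ij; have := heightS w j; lia.
apply/and3P; split.
- case: j jw hl hr => [|j] jw hl hr; first by rewrite take0.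
  apply/coballot_seq_take; first by lia.
  move=> i ij /=; have := heightS w j.
  by have := hl i ij; have := hl j ltac:(lia); lia.
- apply/ballot_seq_drop => // i /andP[].
  by rewrite leq_eqVlt => /orP[/eqP -> //|ji iw]; apply: hr; lia.
case: j jw hl hr => // j jw hl hr /=.
by have := hl j ltac:(lia); have := heightS w j; lia.
Qed.

(** * Exponential generating functions *)

Definition perm_egf (N : nat) (f : seq nat -> {poly rat}) : {poly {poly rat}} :=
  \poly_(i < N) ((i`!%:R^-1 : rat) *: \sum_(p : 'S_i) f (perm_word p)).

Lemma coef_perm_egf N f i : (i < N)%N ->
  (perm_egf N f)`_i = (i`!%:R^-1 : rat) *: \sum_(p : 'S_i) f (perm_word p).
Proof. by rewrite coef_poly => ->. Qed.

(** The binomial coefficients in a product of exponential series are absorbed by [sum_perm_split],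
    so the product sums over all cuts of a word. *)
Lemma coef_perm_egfM N (f g : seq nat -> {poly rat}) i :
    order_invariant f -> order_invariant g -> (i < N)%N ->
  (perm_egf N f * perm_egf N g)`_i = (i`!%:R^-1 : rat) *: \sum_(p : 'S_i)
    \sum_(k < i.+1) f (take k (perm_word p)) * g (drop k (perm_word p)).
Proof.
move=> finv ginv iN; rewrite coefM exchange_big scaler_sumr.
apply: eq_bigr => k _; have [ki kN] := (ltn_ord k, leq_trans (ltn_ord k) iN).
rewrite !coef_perm_egf //; last exact: leq_ltn_trans (leq_subr _ _) iN.
have fact_neq0 j : (j`!)%:R != 0 :> rat by rewrite pnatr_eq0 -lt0n fact_gt0.
case: k ki kN => k /= _ ki _; rewrite ltnS in ki.
(* The degree becomes a variable [j], so that [k + m] can be substituted inside the type ['S_j]. *)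
suff main m j : j = (k + m)%N ->
    (k`!%:R^-1 *: \sum_(p : 'S_k) f (perm_word p)) *
      (m`!%:R^-1 *: \sum_(p : 'S_m) g (perm_word p)) =
    (j`!%:R^-1 : rat) *: \sum_(p : 'S_j)
      f (take k (perm_word p)) * g (drop k (perm_word p)) :> {poly rat}.
  by apply: main; rewrite subnKC.
move=> ->.
apply: (@scalerI _ _ (k`! * m`! * (k + m)`!)%N%:R).
  by rewrite natrM mulf_neq0 // natrM mulf_neq0.
rewrite -scalerAl -scalerAr !scalerA.
have -> : (k`! * m`! * (k + m)`!)%:R * k`!%:R^-1 * m`!%:R^-1 = (k + m)`!%:R :> rat.
  by rewrite !natrM; field; rewrite !fact_neq0.
have -> : (k`! * m`! * (k + m)`!)%:R * (k + m)`!%:R^-1 = (k`! * m`!)%:R :> rat.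
  by rewrite !natrM; field; rewrite fact_neq0.
by rewrite !scaler_nat (sum_perm_split k m finv ginv).
Qed.

(** * Weights on words *)

Definition nonempty_des (w : seq nat) : {poly rat} :=
  if nilp w then 0 else 'X^(des_seq w).

Definition ballot_des (w : seq nat) : {poly rat} :=
  'X^(des_seq w) *+ ballot_seq w.

(** The extra factor ['X] on nonempty words pays for the step at the cut; see
    [sum_coballot_ballot]. *)
Definition coballot_des (w : seq nat) : {poly rat} :=
  if nilp w then 1 else 'X^((des_seq w).+1) *+ coballot_seq w.

(** Its series is J = (exp((1 - t) x) - 1) / (1 - t), which gives the Eulerian series as P = J / (1
    - t J). *)
Definition increasing_wt (w : seq nat) : {poly rat} :=
  if nilp w then 0 else (1 - 'X) ^+ (size w).-1 *+ (des_seq w == 0).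

Lemma nilp_map (T1 T2 : Type) (h : T1 -> T2) (s : seq T1) : nilp (map h s) = nilp s.
Proof. by case: s. Qed.

Lemma nonempty_des_map : order_invariant nonempty_des.
Proof. by move=> h w hm; rewrite /nonempty_des nilp_map des_seq_map. Qed.

Lemma ballot_des_map : order_invariant ballot_des.
Proof. by move=> h w hm; rewrite /ballot_des des_seq_map ?ballot_seq_map. Qed.

Lemma coballot_des_map : order_invariant coballot_des.
Proof.
by move=> h w hm; rewrite /coballot_des nilp_map des_seq_map ?coballot_seq_map.
Qed.

Lemma increasing_wt_map : order_invariant increasing_wt.
Proof.
by move=> h w hm; rewrite /increasing_wt nilp_map size_map des_seq_map.
Qed.

(** A cut at a descent weighs t^des, since the extra ['X] restores the lost descent; a cut at an
    ascent weighs t^(des + 1). Exactly one admissible cut of each sort exists, the cut at 0 counting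
    as a descent and the cut at [size w] as an ascent. *)
Lemma sum_coballot_ballot (w : seq nat) : uniq w ->
  \sum_(k < (size w).+1) coballot_des (take k w) * ballot_des (drop k w)
    = (nilp w)%:R + (1 + 'X) * nonempty_des w.
Proof.
move=> uw; have [w0|w0] := posnP (size w).
  by rewrite (size0nil w0) big_ord1 /= /ballot_des /nonempty_des mulr0 addr0 !mul1r.
have nw : nilp w = false by rewrite /nilp; lia.
pose up j := [&& coballot_seq (take j.+1 w), ballot_seq (drop j.+1 w) &
     (j.+1 == size w) || (nth 0 w j < nth 0 w j.+1)%N].
pose down j := [&& coballot_seq (take j w), ballot_seq (drop j w) &
     (j == 0)%N || (nth 0 w j < nth 0 w j.-1)%N].
have sum_up : \sum_(j < size w) (up j)%:R = 1 :> {poly rat}.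
  by rewrite -natr_sum (sum_cut_ascent w0).
have sum_down : \sum_(j < size w) (down j)%:R = 1 :> {poly rat}.
  by rewrite -natr_sum (sum_cut_descent w0).
rewrite nw add0r /nonempty_des nw.
(* [down k] cuts before the letter [k] but [up k] cuts after it, hence the shift to [up k.-1]. *)
have -> : (1 + 'X) * 'X^(des_seq w) =
  \sum_(k < (size w).+1) (((0 < k)%N && up k.-1)%:R * 'X
    + ((k < size w)%N && down k)%:R) * 'X^(des_seq w) :> {poly rat}.
  rewrite -big_distrl /= big_split /= -big_distrl /=; congr (_ * _); rewrite addrC.
  congr (_ + _).
    rewrite big_ord_recr /= ltnn addr0 -[LHS]sum_down; apply: eq_bigr => i _.
    by rewrite ltn_ord.
  by rewrite big_ord_recl /= add0r sum_up mul1r.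
apply: eq_bigr => -[k /= kw] _; rewrite ltnS in kw.
rewrite /coballot_des /ballot_des /up /down.
have [->|k0] := posnP k.
  rewrite take0 drop0 w0 /= andbT.
  by case: (ballot_seq w) => /=; rewrite ?exprS; ring.
have nk : nilp (take k w) = false by rewrite /nilp size_takel //; lia.
rewrite nk prednK //; have [->|kw'] := eqVneq k (size w).
  rewrite ltnn take_size drop_size.
  rewrite -[des_seq [::]]/0%N -[ballot_seq [::]]/true /= andbT.
  by case: (coballot_seq w) => /=; rewrite ?exprS; ring.
have {kw' kw} kw : (k < size w)%N by lia.
rewrite kw /= (@des_seq_split w k) ?k0 //.
case: (coballot_seq _); last by rewrite /=; rewrite ?exprS; ring.
case: (ballot_seq _); last by rewrite /=; rewrite ?exprS; ring.
have k1 : (k.-1 < k)%N by rewrite ltn_predL.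
have : nth 0%N w k != nth 0%N w k.-1.
  by rewrite nth_uniq ?gtn_eqF // (ltn_trans k1).
by rewrite neq_ltn => /orP[lt|lt]; rewrite lt ltnNge (ltnW lt) /=;
   rewrite ?addn1 ?addn0 ?addSn !(exprS, exprD); ring.
Qed.

(* The products [increasing_wt (take k.+1 w) * nonempty_des (drop k w)], whose
   factors share the letter of index [k], telescope. *)
Lemma sum_increasing_prefix (w : seq nat) :
  \sum_(k < (size w).+1) increasing_wt (take k w) * nonempty_des (drop k w) * 'X
    + increasing_wt w = nonempty_des w.
Proof.
case: (posnP (size w)) => [w0|w0].
  by rewrite (size0nil w0) big_ord1 /= /increasing_wt /nonempty_des !mul0r add0r.
case sw: (size w) w0 => [//|n] _.
have nw : nilp w = false by rewrite /nilp sw.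
rewrite big_ord_recr big_ord_recl /= take0 {1}/increasing_wt /= !mul0r add0r.
rewrite -sw drop_size {2}/nonempty_des /= mulr0 mul0r addr0.
pose T k : {poly rat} := increasing_wt (take k.+1 w) * nonempty_des (drop k w).
have T0 : T 0%N = nonempty_des w.
  rewrite /T drop0; case: (w) sw => // x s _.
  by rewrite /= take0 /increasing_wt /= mul1r.
have Tn : T n = increasing_wt w.
  rewrite /T -sw take_size /nonempty_des /nilp size_drop sw subSnn /=.
  suff -> : des_seq (drop n w) = 0%N by rewrite mulr1.
  by rewrite des_seqE size_drop sw subSnn big_geq.
rewrite -T0 -Tn -[RHS](addrNK (T n)); congr (_ + _).
rewrite -[RHS]opprB -(telescope_sumr T (leq0n n)) big_mkord -sumrN.
apply: eq_bigr => -[k /= kn] _; rewrite opprB /bump leq0n add1n /T.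
have k2w : (k.+2 <= size w)%N by rewrite sw.
have k1w : (k.+1 <= size w)%N by exact: ltnW.
rewrite /increasing_wt /nonempty_des /nilp !size_takel // !size_drop.
have -> : (size w - k.+1 == 0)%N = false by lia.
have -> : (size w - k == 0)%N = false by lia.
rewrite /= !des_seq_take //= big_nat_recr //= !des_seq_drop.
rewrite (big_ltn (m := k)) /=; last by rewrite sw.
(* At a descent [T k.+1] is zero and [T k] contains the factor ['X] of that descent; otherwise
   [T k.+1] is [(1 - 'X) * T k]. *)
case: (_ < _)%N => /=; rewrite ?addn1 ?addn0 ?add1n ?add0n ?exprS; last by ring.
by case: (_ == 0)%N => /=; ring.
Qed.

Lemma des_perm_eq0 n (p : 'S_n) : (des_seq (perm_word p) == 0%N) = (p == 1%g).
Proof.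
have wid : perm_word (1%g : 'S_n) = iota 0 n.
  by rewrite /perm_word -val_enum_ord; apply: eq_map => i; rewrite perm1.
apply/eqP/eqP => [des0|->]; last first.
  rewrite wid /des_seq size_iota; apply/eqP; rewrite -leqn0 leqNgt -has_count.
  apply/hasPn => i; rewrite mem_iota => ilt; rewrite !nth_iota; lia.
suff wp : perm_word p = perm_word (1%g : 'S_n).
  by apply/permP => i; apply: val_inj; rewrite /= -!nth_perm_word wp.
rewrite wid; apply: (irr_sorted_eq ltn_trans ltnn).
- apply/(sortedP 0%N) => i ilt.
  rewrite ltn_neqAle nth_uniq ?perm_word_uniq //; last exact: ltnW.
  rewrite ltn_eqF //= leqNgt; apply/negP => ides.
  suff : (0 < des_seq (perm_word p))%N by rewrite des0.
  by rewrite -has_count; apply/hasP; exists i => //; rewrite mem_iota; lia.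
- exact: iota_ltn_sorted.
move=> i; rewrite mem_iota add0n /=; apply/mapP/idP => [[j _ ->] //|ilt].
by exists ((p^-1)%g (Ordinal ilt)); rewrite ?mem_enum // permKV.
Qed.

Lemma sum_increasing_wt n :
  \sum_(p : 'S_n.+1) increasing_wt (perm_word p) = (1 - 'X) ^+ n.
Proof.
rewrite (bigD1 1%g) //= big1 ?addr0 => [|p p1];
  rewrite /increasing_wt /nilp size_perm_word /= des_perm_eq0.
  by rewrite eqxx.
by rewrite (negbTE p1).
Qed.

(** * Power series modulo a power of the variable *)

Definition vanish (R : nzRingType) (N : nat) (p : {poly R}) : Prop :=
  forall i, (i < N)%N -> p`_i = 0.

Lemma vanishD (R : nzRingType) N (p q : {poly R}) :
  vanish N p -> vanish N q -> vanish N (p + q).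
Proof. by move=> hp hq i iN; rewrite coefD hp ?hq ?addr0. Qed.

Lemma vanishN (R : nzRingType) N (p : {poly R}) : vanish N p -> vanish N (- p).
Proof. by move=> hp i iN; rewrite coefN hp ?oppr0. Qed.

Lemma vanishM (R : nzRingType) a b (p q : {poly R}) :
  vanish a p -> vanish b q -> vanish (a + b) (p * q).
Proof.
move=> hp hq i iab; rewrite coefM big1 // => k _.
have [ka|ak] := ltnP k a; first by rewrite hp ?mul0r.
by rewrite hq ?mulr0 //; have := ltn_ord k; lia.
Qed.

Lemma vanishMl (R : nzRingType) N (p q : {poly R}) : vanish N q -> vanish N (p * q).
Proof. exact: (@vanishM R 0). Qed.

Lemma vanish_leq (R : nzRingType) M N (p : {poly R}) :
  (M <= N)%N -> vanish N p -> vanish M p.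
Proof. by move=> MN hp i iM; apply: hp; apply: leq_trans MN. Qed.

Lemma vanish_deriv (R : nzRingType) N (p : {poly R}) :
  vanish N.+1 p -> vanish N p^`().
Proof. by move=> hp i iN; rewrite coef_deriv hp ?mul0rn. Qed.

(** A series with constant term 1 is invertible and can be cancelled. *)
Lemma vanish_regular (R : nzRingType) N (u p : {poly R}) :
  u`_0 = 1 -> vanish N (u * p) -> vanish N p.
Proof.
move=> u0 hup; elim/ltn_ind => i IH iN.
have := hup i iN; rewrite coefM big_ord_recl u0 mul1r subn0 big1 ?addr0 // => k _.
by rewrite IH ?mulr0 //= /bump; have := ltn_ord k; lia.
Qed.

Lemma coef_comp_oppX (R : comNzRingType) (p : {poly R}) i :
  (p \Po (- 'X))`_i = (-1) ^+ i * p`_i.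
Proof.
have oppXn k : ((- 'X) ^+ k)`_i = (-1) ^+ k * (i == k)%:R :> R.
  have -> : - 'X = (-1)%:P * 'X :> {poly R} by rewrite polyCN mulN1r.
  by rewrite exprMn -polyC_exp coefCM coefXn.
rewrite coef_comp_poly; have [ip|pi] := ltnP i (size p).
  rewrite (bigD1 (Ordinal ip)) //= big1 ?addr0 => [|k ki].
    by rewrite oppXn eqxx mulr1 mulrC.
  rewrite oppXn; have -> : (i == k)%N = false.
    by apply/eqP => e; case/eqP: ki; apply: val_inj.
  by rewrite !mulr0.
rewrite big1 => [|k _]; first by rewrite nth_default ?mulr0.
rewrite oppXn; have -> : (i == k)%N = false by rewrite gtn_eqF // (leq_trans _ pi).
by rewrite !mulr0.
Qed.

Lemma vanish_comp_oppX (R : comNzRingType) N (p : {poly R}) :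
  vanish N p -> vanish N (p \Po (- 'X)).
Proof. by move=> hp i iN; rewrite coef_comp_oppX hp ?mulr0. Qed.

(** Uniqueness for p' = a p with p(0) = 0: coefficient m + 1 of p is determined by the lower ones,
    in characteristic zero. *)
Lemma vanish_ode N (a p : {poly {poly rat}}) :
  p`_0 = 0 -> vanish N (p^`() - a * p) -> vanish N.+1 p.
Proof.
move=> p0 hp; suff H m : (m <= N)%N -> vanish m.+1 p by apply: H.
elim: m => [_ [|]//|m IH mN i]; rewrite ltnS leq_eqVlt => /orP[/eqP ->|]; last first.
  by apply: IH; apply: ltnW.
have hm : vanish m.+1 (a * p) by apply: vanishMl; apply: IH; apply: ltnW.
have := hp m mN; rewrite coefB (hm m) // subr0 coef_deriv -scaler_nat => /eqP.
by rewrite scaler_eq0 pnatr_eq0 => /eqP.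
Qed.

(** Differentiate P = J / (1 - t J), using J' = 1 + (1 - t) J; the unit 1 - t J is cleared to avoid
    division. *)
Lemma vanish_deriv_eulerian n (t : {poly rat}) (J P : {poly {poly rat}}) :
    J`_0 = 0 -> vanish n (J^`() - (1 + (1 - t%:P) * J)) ->
    vanish n.+1 (P - (t%:P * J * P + J)) ->
  vanish n (P^`() - (1 + P) * (1 + t%:P * P)).
Proof.
move=> J0 JE PE; apply: (@vanish_regular _ _ (1 - t%:P * J)).
  by rewrite coefB coef0M J0 mulr0 subr0 coef1.
set D := P - _ in PE; set K := J^`() - _ in JE.
have -> : (1 - t%:P * J) * (P^`() - (1 + P) * (1 + t%:P * P))
   = D^`() + (1 + t%:P * P) * (K - D).
  by rewrite /D /K !(derivE, derivM); ring.
apply: vanishD; first exact: vanish_deriv.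
apply: vanishMl; apply: vanishD => //; apply: vanishN.
exact: vanish_leq PE.
Qed.

(** This is P(-x) = -P / (1 + (1 + t) P), obtained from a linear differential equation with zero
    initial value. *)
Lemma vanish_eulerian_opp n (t : {poly rat}) (P : {poly {poly rat}}) :
    P`_0 = 0 -> vanish n (P^`() - (1 + P) * (1 + t%:P * P)) ->
  vanish n.+1 ((P \Po (- 'X)) * (1 + (1 + t%:P) * P) + P).
Proof.
set F := _ - _ => P0 hF; set Q := P \Po (- 'X); set E := (X in vanish _ X).
have Q' : Q^`() = - ((F \Po (- 'X)) + (1 + Q) * (1 + t%:P * Q)).
  have -> : F \Po (- 'X) = (P^`() \Po (- 'X)) - (1 + Q) * (1 + t%:P * Q).
    by rewrite /F comp_polyB !comp_polyM !comp_polyD comp_polyM !comp_polyC -/Q.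
  by rewrite /Q deriv_comp derivN derivX; ring.
(* [E' = t (P - Q) E] modulo the equation for [P]. *)
apply: (@vanish_ode _ (t%:P * (P - Q))).
  by rewrite coefD coef0M coef_comp_oppX P0 !mulr0 mul0r addr0.
have -> : E^`() - t%:P * (P - Q) * E =
   - ((1 + (1 + t%:P) * P) * (F \Po (- 'X))) + ((1 + t%:P) * Q + 1) * F.
  by rewrite /E !(derivE, derivM) Q' /F; ring.
by apply: vanishD; [apply/vanishN|]; apply: vanishMl => //; apply: vanish_comp_oppX.
Qed.

(** The logarithmic derivative is 1 + t + t (1 + t) P^2 / (1 + (1 + t) P), and [vanish_eulerian_opp]
    turns (1 + t) P^2 / (1 + (1 + t) P) into P(x) + P(-x). *)
Lemma vanish_log_deriv n (t : {poly rat}) (P : {poly {poly rat}}) :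
    P`_0 = 0 -> vanish n (P^`() - (1 + P) * (1 + t%:P * P)) ->
  vanish n ((1 + (1 + t%:P) * P)^`()
    - (1 + (1 + t%:P) * P) * (1 + t%:P + t%:P * (P + (P \Po (- 'X))))).
Proof.
move=> P0 hF; have hE := vanish_eulerian_opp P0 hF.
set Q := P \Po (- 'X) in hE *; set F := _ - _ in hF.
set E := (X in vanish _ X) in hE.
have -> : (1 + (1 + t%:P) * P)^`()
    - (1 + (1 + t%:P) * P) * (1 + t%:P + t%:P * (P + Q))
    = (1 + t%:P) * F - t%:P * E.
  by rewrite !(derivE, derivM) /F /E; ring.
apply: vanishD; first exact: vanishMl.
by apply: vanishN; apply: vanishMl; apply: vanish_leq hE.
Qed.

(** * Supports in the exponents of x and t *)

(* [f] has support in the pairs (power of x, power of t) satisfying [S]. *)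
Definition supported (N : nat) (S : nat -> nat -> bool)
    (f : {poly {poly rat}}) : Prop :=
  forall i j, (i < N)%N -> ~~ S i j -> (f`_i)`_j = 0.

Lemma supportedB N S f g :
  supported N S f -> supported N S g -> supported N S (f - g).
Proof. by move=> hf hg i j iN nS; rewrite !coefB hf ?hg ?subr0. Qed.

Lemma supportedM N (S1 S2 S : nat -> nat -> bool) f g :
    (forall i j k l, S1 i j -> S2 k l -> S (i + k)%N (j + l)%N) ->
    supported N S1 f -> supported N S2 g -> supported N S (f * g).
Proof.
move=> hS hf hg i j iN nS; rewrite coefM coef_sum big1 // => -[k /= ki] _.
rewrite coefM big1 // => -[l /= lj] _.
have [s1|s1] := boolP (S1 k l); last by rewrite hf ?mul0r //; lia.
rewrite hg ?mulr0 //; first by lia.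
apply: contra nS => s2; have := hS _ _ _ _ s1 s2.
by rewrite !subnKC.
Qed.

(* The uniqueness of a Wiener-Hopf factorisation: the logarithmic derivatives of
   [U] and [V] live in complementary half-planes of exponents. *)
Lemma wiener_hopf_deriv n (U V G H : {poly {poly rat}}) :
    U`_0 = 1 -> V`_0 = 1 ->
    supported n (fun i j => 2 * j <= i)%N U ->
    supported n (fun i j => 2 * j <= i)%N U^`() ->
    supported n (fun i j => 2 * j <= i)%N G ->
    supported n (fun i j => i <= 2 * j)%N V ->
    supported n (fun i j => i + 2 <= 2 * j)%N V^`() ->
    supported n (fun i j => i + 2 <= 2 * j)%N H ->
    vanish n ((V * U)^`() - (V * U) * (G + H)) ->
  vanish n (U^`() - U * G).
Proof.
move=> U0 V0 sU sU' sG sV sV' sH hVU.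
pose alpha := U^`() - U * G; pose beta := V^`() - V * H.
have ha : supported n (fun i j => 2 * j <= i)%N alpha.
  by apply: supportedB => //; apply: supportedM sU sG => *; lia.
have hb : supported n (fun i j => i + 2 <= 2 * j)%N beta.
  by apply: supportedB => //; apply: supportedM sV sH => *; lia.
have hab : vanish n (V * alpha + U * beta).
  suff -> : V * alpha + U * beta = (V * U)^`() - (V * U) * (G + H) by [].
  by rewrite /alpha /beta derivM; ring.
suff main i : (i < n)%N -> alpha`_i = 0 /\ beta`_i = 0.
  by move=> i /main[].
(* Once the lower coefficients vanish, degree [i] of [hab] reads [alpha]_i + beta[_i = 0], and the
   two summands have no power of t in common. *)
elim/ltn_ind: i => i IH iN.
have : alpha`_i + beta`_i = 0.
  have := hab i iN; rewrite coefD !coefM !big_ord_recl V0 U0 !mul1r subn0.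
  rewrite big1 => [|k _].
    rewrite big1 => [|k _]; first by rewrite !addr0.
    have [||_ ->] := IH (i - bump 0 k)%N; rewrite ?mulr0 // /bump /=;
      by have := ltn_ord k; lia.
  have [||-> _] := IH (i - bump 0 k)%N; rewrite ?mulr0 // /bump /=;
      by have := ltn_ord k; lia.
move=> hs; suff ai : alpha`_i = 0 by rewrite ai add0r in hs.
apply/polyP => j; rewrite coef0; have [ji|ij] := leqP (2 * j) i; last first.
  by apply: ha => //; rewrite -ltnNge.
move: (congr1 (fun p : {poly rat} => p`_j) hs); rewrite coefD coef0.
by rewrite (hb i j) ?addr0 //; lia.
Qed.

(** * The truncated exponential and its exponent *)

(** Differentiation loses only the last term of the exponential, a multiple of g^n, which has order
    at least n because g has no constant term. *)
Lemma vanish_exp_trunc n (g : {poly {poly rat}}) : g`_0 = 0 ->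
  vanish n ((exp_trunc n g)^`() - g^`() * exp_trunc n g).
Proof.
move=> g0; pose c j : {poly {poly rat}} := (((j`!)%:R^-1 : rat)%:P)%:P.
have cS j : c j.+1 *+ j.+1 = c j.
  rewrite /c -!rmorphMn /= -mulr_natr; do 2 congr (_%:P).
  by rewrite factS natrM invfM mulrAC mulVf ?mul1r // pnatr_eq0.
have gX k : vanish k (g ^+ k).
  elim: k => [//|k IH]; rewrite exprS -add1n; apply: vanishM => // i.
  by rewrite ltnS leqn0 => /eqP ->.
pose S := \sum_(j < n) c j * g ^+ j.
have expE : exp_trunc n g = S + c n * g ^+ n by rewrite /exp_trunc big_ord_recr.
have -> : (exp_trunc n g)^`() = g^`() * S.
  rewrite /exp_trunc big_ord_recl /= derivD expr0 mulr1 derivC add0r.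
  rewrite raddf_sum big_distrr; apply: eq_bigr => j _ /=.
  rewrite -/(c j.+1) deriv_mulC deriv_exp -[c j in RHS]cS /bump leq0n add1n.
  by rewrite !(mulrnAl, mulrnAr) mulrCA.
have -> : g^`() * S - g^`() * exp_trunc n g = - (g^`() * c n) * g ^+ n.
  by rewrite expE; ring.
exact: vanishMl.
Qed.

Lemma exp_trunc_coef0 n (g : {poly {poly rat}}) : g`_0 = 0 -> (exp_trunc n g)`_0 = 1.
Proof.
move=> g0; rewrite /exp_trunc coef_sum big_ord_recl big1 => [|j _].
  by rewrite expr0 mulr1 coefC /= invr1 addr0.
by rewrite coefCM exprS coef0M g0 mul0r mulr0.
Qed.

(** Beyond the monomial x, only k = [m./2] and d = [j.-1] can contribute. *)
Lemma coef_exponent_trunc N m j :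
  ((exponent_trunc N)`_m)`_j =
  ((m == 1%N) && (j == 0%N))%:R +
  (if [&& odd m, 1 < m <= N.*2.+1 & 0 < j <= m./2]%N
   then 2%:R * ((eulerian m.-1 j.-1)%:R / m`!%:R) else 0).
Proof.
rewrite /exponent_trunc coefD coefX coefD; congr (_ + _).
  by case: eqP => _; rewrite ?coef1 ?coef0 //= mulr1n; case: eqP.
rewrite mulr_natl coefMn coef_sum coefMn coef_sum.
pose inner k := \sum_(d < k)
  (((eulerian (2 * k) d)%:R / ((2 * k).+1)`!%:R : rat) *: 'X^(d.+1)).
have inner_coef k : (inner k)`_j = if (0 < j <= k)%N then
    (eulerian (2 * k) j.-1)%:R / ((2 * k).+1)`!%:R else 0.
  rewrite /inner coef_sum; case: ifP => jk.
    have jk' : (j.-1 < k)%N by lia.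
    rewrite (bigD1 (Ordinal jk')) //= big1 ?addr0 => [|d dj].
      by rewrite coefZ coefXn prednK ?eqxx ?mulr1 //; lia.
    rewrite coefZ coefXn; case: eqP => [e|_]; last by rewrite mulr0.
    by case/eqP: dj; apply: val_inj; rewrite /= e.
  rewrite big1 // => d _.
  rewrite coefZ coefXn; case: eqP => [e|_]; last by rewrite mulr0.
  by have := ltn_ord d; lia.
have -> : \sum_(1 <= k < N.+1)
   ((\sum_(d < k) (((eulerian (2 * k) d)%:R / ((2 * k).+1)`!%:R : rat)
      *: 'X^(d.+1))%:P * 'X^((2 * k).+1))`_m)`_j =
   \sum_(1 <= k < N.+1) (if (m == (2 * k).+1)%N then (inner k)`_j else 0) :> rat.
  apply: eq_bigr => k _; rewrite -big_distrl -rmorph_sum /= coefCM coefXn.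
  by case: eqP => _; rewrite ?mulr1 // mulr0 coef0.
have [mk|mk] := boolP (odd m && (1 < m <= N.*2.+1)%N); last first.
  rewrite big_nat big1 ?mul0rn => [|k kN].
    by rewrite andbA (negbTE mk).
  by case: eqP => // e; case/negP: mk; lia.
rewrite andbA mk /= (bigD1_seq m./2) /=; last 2 first.
- by rewrite mem_index_iota; lia.
- exact: iota_uniq.
rewrite big1 ?addr0 => [|k kneq]; last first.
  by case: eqP => // e; case/eqP: kneq; lia.
have e2 : (2 * m./2)%N = m.-1 by lia.
have e3 : m.-1.+1 = m by lia.
rewrite e2 e3 eqxx inner_coef e2 e3; case: ifP => _; last by rewrite mul0rn.
by rewrite [RHS]mulr_natl.
Qed.

(** * Supports of the ballot and coballot series *)

Lemma asc_add_des (w : seq nat) : uniq w -> (asc_seq w + des_seq w)%N = (size w).-1.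
Proof.
move=> uw; rewrite asc_seqE des_seqE -big_split /=.
rewrite -[RHS]muln1 -[X in (X * _)%N]subn0 -sum_nat_const_nat.
apply: eq_big_nat => j /andP[_ jw].
have {}jw : (j.+1 < size w)%N by lia.
have : nth 0%N w j != nth 0%N w j.+1 by rewrite nth_uniq ?ltn_eqF // ltnW.
by rewrite neq_ltn => /orP[lt|lt]; rewrite lt ltnNge (ltnW lt).
Qed.

Lemma supported_sub N (S1 S2 : nat -> nat -> bool) f :
  (forall i j, S1 i j -> S2 i j) -> supported N S1 f -> supported N S2 f.
Proof. by move=> hS hf i j iN nS; apply: hf => //; apply: contra nS; apply: hS. Qed.

Lemma supported_leq M N (S : nat -> nat -> bool) f :
  (M <= N)%N -> supported N S f -> supported M S f.
Proof. by move=> MN hf i j iM; apply: hf; apply: leq_trans MN. Qed.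

Lemma supported_deriv N (S : nat -> nat -> bool) f :
  supported N.+1 S f -> supported N (fun i j => S i.+1 j) f^`().
Proof. by move=> hf i j iN nS; rewrite coef_deriv coefMn hf ?mul0rn. Qed.

Lemma supported_perm_egf N (S : nat -> nat -> bool) (f : seq nat -> {poly rat}) :
    (forall (w : seq nat) j, uniq w -> ~~ S (size w) j -> (f w)`_j = 0) ->
  supported N S (perm_egf N f).
Proof.
move=> hf i j iN nS; rewrite coef_perm_egf // coefZ coef_sum big1 ?mulr0 // => p _.
by rewrite hf ?perm_word_uniq ?size_perm_word.
Qed.

(** At most half of the [i.-1] steps are descents. The bound with [i.-1] leaves room for
    differentiation. *)
Lemma supported_ballot N :
  supported N (fun i j => 2 * j <= i.-1)%N (perm_egf N ballot_des).
Proof.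
apply: supported_perm_egf => w j uw nS; rewrite /ballot_des coefMn coefXn.
case: eqP => [ej|_]; last by rewrite mul0rn.
rewrite {}ej in nS.
case: (boolP (ballot_seq w)) => // /allP bw.
have := bw (size w); rewrite mem_iota ltnSn => /(_ isT); rewrite take_size.
by have := asc_add_des uw; move=> *; exfalso; lia.
Qed.

(** At least half of the i - 1 steps are descents and the weight adds one, so 2j >= i + 1; the term
    [(0 < i)] exempts the empty word. *)
Lemma supported_coballot N :
  supported N (fun i j => i + (0 < i) <= 2 * j)%N (perm_egf N coballot_des).
Proof.
apply: supported_perm_egf => w j uw nS; rewrite /coballot_des /nilp.
case: eqP => [w0|/eqP w0].
  by move: nS; rewrite w0 coef1 /=; case: j.
rewrite coefMn coefXn; case: eqP => [ej|_]; last by rewrite mul0rn.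
rewrite {}ej in nS.
case: (boolP (coballot_seq w)) => // /allP bw.
have := bw 0%N; rewrite mem_iota lt0n w0 => /(_ isT); rewrite drop0.
by have := asc_add_des uw; move=> *; exfalso; lia.
Qed.

Lemma perm_egf_coef0 N f : (perm_egf N.+1 f)`_0 = f [::].
Proof.
rewrite coef_perm_egf // invr1 scale1r.
rewrite (eq_bigr (fun=> f [::])) ?sum_const_perm // => p _.
by congr f; apply: size0nil; rewrite size_perm_word.
Qed.

Lemma coef_nonempty_des N i j : (0 < i < N)%N ->
  ((perm_egf N nonempty_des)`_i)`_j = (eulerian i j)%:R / i`!%:R.
Proof.
move=> /andP[i0 iN]; rewrite coef_perm_egf // coefZ mulrC coef_sum; congr (_ / _).
rewrite /eulerian -sum1_card natr_sum [RHS]big_mkcond; apply: eq_bigr => p _ /=.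
rewrite inE /nonempty_des /nilp size_perm_word eqn0Ngt i0 coefXn eq_sym /des_perm.
by case: eqP.
Qed.

(** * Functional equations of the series *)

Lemma coballot_ballot_egf n :
  vanish n.+1 (perm_egf n.+1 coballot_des * perm_egf n.+1 ballot_des
    - (1 + (1 + 'X%:P) * perm_egf n.+1 nonempty_des)).
Proof.
move=> i iN; rewrite coefB (coef_perm_egfM coballot_des_map ballot_des_map) //.
rewrite coefD mulrDl mul1r coefD coefCM coef1 coef_perm_egf //.
rewrite (eq_bigr (fun p => (nilp (perm_word p))%:R +
  (1 + 'X) * nonempty_des (perm_word p))); last first.
  move=> p _; rewrite -sum_coballot_ballot ?perm_word_uniq //.
  by rewrite size_perm_word.
rewrite big_split /= -big_distrr /= scalerDr.
have -> : i`!%:R^-1 *: \sum_(p : 'S_i) (nilp (perm_word p))%:R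
    = (i == 0%N)%:R :> {poly rat}.
  rewrite (eq_bigr (fun=> (i == 0%N)%:R)) => [|p _]; last first.
    by rewrite /nilp size_perm_word.
  rewrite sum_const_perm -scaler_nat scalerA mulVf ?scale1r //.
  by rewrite pnatr_eq0 -lt0n fact_gt0.
by rewrite scalerAr mulrDl mul1r subrr.
Qed.

Lemma increasing_prefix_egf n :
  vanish n.+1 (perm_egf n.+1 nonempty_des
    - ('X%:P * perm_egf n.+1 increasing_wt * perm_egf n.+1 nonempty_des
       + perm_egf n.+1 increasing_wt)).
Proof.
move=> i iN; rewrite coefB coefD -mulrA coefCM.
rewrite (coef_perm_egfM increasing_wt_map nonempty_des_map) //.
rewrite !coef_perm_egf // -scalerAr -scalerDr -scalerBr big_distrr -big_split /=.
rewrite -sumrB big1 ?scaler0 // => p _.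
rewrite -[in X in X - _](sum_increasing_prefix (perm_word p)) size_perm_word.
by rewrite -big_distrl /= mulrC subrr.
Qed.

Lemma increasing_egf_deriv n :
  vanish n ((perm_egf n.+1 increasing_wt)^`()
    - (1 + (1 - 'X%:P) * perm_egf n.+1 increasing_wt)).
Proof.
have factV i : (i.+1`!%:R^-1 : rat) * i.+1%:R = i`!%:R^-1.
  by rewrite factS natrM invfM mulrAC mulVf ?mul1r // pnatr_eq0.
move=> i iN; rewrite coefB coef_deriv coefD mulrBl mul1r coefB coefCM coef1.
rewrite coef_perm_egf // sum_increasing_wt -scaler_nat scalerA mulrC factV.
case: i iN => [|i] iN.
  by rewrite perm_egf_coef0 /increasing_wt /= expr0 invr1 scale1r; ring.
rewrite coef_perm_egf ?sum_increasing_wt; last exact: ltnW.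
by rewrite -!mul_polyC exprS /=; ring.
Qed.

Lemma exponent_trunc_coef0 n : (exponent_trunc n)`_0 = 0.
Proof. by apply/polyP => j; rewrite coef_exponent_trunc coef0 addr0. Qed.

Lemma supported_exponent_deriv n :
  supported n (fun i j => 2 * j <= i)%N (exponent_trunc n)^`().
Proof.
move=> i j iN nS; rewrite coef_deriv coefMn coef_exponent_trunc.
have -> : ((i.+1 == 1%N) && (j == 0%N)) = false by lia.
by case: ifP => [|_]; [lia | rewrite addr0 mul0rn].
Qed.

(** In P(x) + P(-x) odd degrees cancel and even degrees double, so the terms with 2j <= i are
    exactly those of the derivative of the exponent; for even i the others satisfy 2j >= i + 2. *)
Lemma supported_exponent_complement n :
  let P := perm_egf n.+1 nonempty_des in
  supported n (fun i j => i + 2 <= 2 * j)%N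
    (1 + 'X%:P + 'X%:P * (P + (P \Po (- 'X))) - (exponent_trunc n)^`()).
Proof.
move=> P i j iN nS; rewrite !(coefB, coefD) coefCM coefXM !coefD coef_comp_oppX.
rewrite coef_deriv coef1 coefC !coefMn coef_exponent_trunc -signr_odd.
have [i_eq0|i0] := posnP i.
  have -> : j = 0%N by lia.
  by rewrite i_eq0 /= coefX coef1 /=; ring.
have -> : (i.+1 == 1%N) && (j == 0%N) = false by lia.
rewrite mulr0n coef0 !add0r; case: j nS => [|j] nS.
  by rewrite !andbF mul0rn subrr.
have [oi|oi] := boolP (odd i).
  by rewrite /= oi expr1 mulN1r coefN subrr mul0rn subr0.
rewrite /= oi expr0 mul1r !coef_nonempty_des; last by lia.
have -> : (0 < i <= n.*2)%N && (j < uphalf i)%N by lia.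
have fi : i`!%:R != 0 :> rat by rewrite pnatr_eq0 -lt0n fact_gt0.
have i1 : i.+1%:R != 0 :> rat by rewrite pnatr_eq0.
rewrite /= factS natrM -[X in _ - X]mulr_natr; field.
by rewrite fi nat1r i1.
Qed.

(** * Identification of the ballot series *)

Lemma ballot_egf_exp n :
  vanish n.+1 (perm_egf n.+1 ballot_des - exp_trunc n (exponent_trunc n)).
Proof.
set U := perm_egf _ _; set g := exponent_trunc n; set e := exp_trunc n g.
pose V := perm_egf n.+1 coballot_des; pose P := perm_egf n.+1 nonempty_des.
have g0 : g`_0 = 0 by exact: exponent_trunc_coef0.
have U0 : U`_0 = 1 by rewrite /U perm_egf_coef0 /ballot_des mulr1n expr0.
have V0 : V`_0 = 1 by rewrite /V perm_egf_coef0.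
have P0 : P`_0 = 0 by rewrite /P perm_egf_coef0.
have J0 : (perm_egf n.+1 increasing_wt)`_0 = 0 by rewrite perm_egf_coef0.
have PE := vanish_deriv_eulerian J0
  (@increasing_egf_deriv n) (@increasing_prefix_egf n).
have LE := vanish_log_deriv P0 PE; have VU := @coballot_ballot_egf n.
rewrite -/P in PE LE; rewrite -/P -/U -/V in VU.
(* The part of the logarithmic derivative of [V * U] that belongs to [V]. *)
pose H := 1 + 'X%:P + 'X%:P * (P + (P \Po (- 'X))) - g^`().
have hU : vanish n (U^`() - U * g^`()).
  apply: (wiener_hopf_deriv U0 V0 (H := H)).
  - have hs := supported_leq (leqnSn n) (@supported_ballot n.+1).
    by apply: supported_sub _ hs => i j; lia.
  - have hs := supported_deriv (@supported_ballot n.+1).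
    by apply: supported_sub _ hs => i j; lia.
  - exact: supported_exponent_deriv.
  - have hs := supported_leq (leqnSn n) (@supported_coballot n.+1).
    by apply: supported_sub _ hs => i j; lia.
  - have hs := supported_deriv (@supported_coballot n.+1).
    by apply: supported_sub _ hs => i j; lia.
  - exact: supported_exponent_complement.
  set D := _ - _ in VU; set K := _ - _ in LE.
  have -> : (V * U)^`() - V * U * (g^`() + H)
     = D^`() + K - D * (1 + 'X%:P + 'X%:P * (P + (P \Po (- 'X)))).
    by rewrite /D /K /H derivB; ring.
  apply: vanishD; first by apply: vanishD => //; apply: vanish_deriv.
  by apply: vanishN; rewrite mulrC; apply: vanishMl; apply: vanish_leq VU.
(* [U] and [e] have constant term 1 and the same logarithmic derivative, so their difference solves
   a linear equation with zero initial value. *)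
apply: (@vanish_ode _ g^`()); first by rewrite coefB U0 exp_trunc_coef0 ?subrr.
have he := @vanish_exp_trunc n g g0; rewrite -/e in he.
have -> : (U - e)^`() - g^`() * (U - e)
   = (U^`() - U * g^`()) - (e^`() - g^`() * e) by rewrite derivB; ring.
by apply: vanishD => //; apply: vanishN.
Qed.

(* Coefficientwise form of B^des(x,t) = exp(x + 2 sum ...): for every n, the
   coefficient of x^n/n! on both sides agree (the truncations used on the right
   do not affect the coefficient of x^n since the exponent has no constant term). *)
Theorem theorem3p9 (n : nat) :
  Bdes_coef n = (n`!)%:R *: (exp_trunc n (exponent_trunc n))`_n.
Proof.
have := @ballot_egf_exp n n (ltnSn n); rewrite coefB => /eqP.
rewrite subr_eq0 => /eqP <-; rewrite coef_perm_egf // scalerA.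
rewrite mulfV ?scale1r; last first.
  by rewrite pnatr_eq0 -lt0n fact_gt0.
rewrite /Bdes_coef big_mkcond; apply: eq_bigr => p _.
by rewrite ballotE /ballot_des /des_perm; case: ifP.
Qed.
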